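(* Let $n \geq 1$ and fix $\lambda^{(1)},\lambda^{(2)},\lambda^{(3)},\lambda^{(4)} \in \{1,2,3,4\}^n$; write $\boldsymbol{\lambda}=(\lambda^{(1)},\ldots,\lambda^{(4)})$. Then the following sets are in bijection: (1) the set $\mathcal{T}_{4,n}(\boldsymbol{\lambda})$ of interlacing triangular arrays of rank $4$ and height $n$ with top row $\boldsymbol{\lambda}$; (2) the set $\mathcal{D}_n(\boldsymbol{\lambda})$ of those edge labelings in $\mathcal{D}_n$ of the square grid graph $\square_n$ that have boundary conditions $\boldsymbol{\lambda}$.
   Context: **Interlacing triangular arrays.** An interlacing triangular array $T$ of rank $m$ and height $n$ is a collection $\{T^{(i)}_{j,k} : 1\le i\le m,\ 1\le j\le k\le n\}$ of elements of $\{1,\dots,m\}$ such that: (a) for each $k=1,\dots,n$, the multiset $\{T^{(i)}_{j,k} : 1\le i\le m,\ 1\le j\le k\}$ contains each of $1,\dots,m$ exactly $k$ times; (b) let $h(i,j,k)=in+j-(n+k)/2$. If $T^{(i)}_{j,k}=T^{(i')}_{j',k}=a$ with $h(i,j,k)<h(i',j',k)$, then there exist $i'',j''$ with $T^{(i'')}_{j'',k-1}=a$ and $h(i,j,k)<h(i'',j'',k-1)<h(i',j',k)$. $\mathcal{T}_{m,n}(\lambda^{(1)},\dots,\lambda^{(m)})$ is the set of such arrays whose top row is $\boldsymbol\lambda$, i.e. $(T^{(i)}_{1,n},\dots,T^{(i)}_{n,n})=\lambda^{(i)}$ for all $i$. **Square grid labelings.** $\square_n$ is the square grid graph with side length $n$,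 having $(n+1)^2$ vertices and $n^2$ unit square faces, embedded in the plane; the base point is its southwest corner. $\mathcal{D}_n$ is the set of labelings of the edges of $\square_n$ by $\{1,2,3,4\}$ such that: - for each of the $n$ faces on the main southwest-to-northeast diagonal, all four edges are labeled differently; - for each other face, the four edges carry exactly two distinct labels, and either one label is on the west and south edges and the other label is on the north and east edges, or one label is on the north and south edges and the other label is on the west and east edges. The boundary conditions of a labeling are the four strings read clockwise from the base point: west side (bottom to top), north side (left to right), east side (top to bottom), south side (right to left). $\mathcal{D}_n(\boldsymbol{\lambda})$ is the set of labelings in $\mathcal{D}_n$ with boundary conditions $(\lambda^{(1)},\lambda^{(2)},\lambda^{(3)},\lambda^{(4)})$. *)

(* Defs.v *)
From mathcomp Require Import all_boot all_order all_algebra.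
Set Implicit Arguments.
Unset Strict Implicit.
Unset Printing Implicit Defensive.
Import Order.TTheory GRing.Theory Num.Theory.

(* All index sets {1..r} are encoded as 'I_r = {0..r-1}; the same holds for the
   labels {1..m}, which are only ever compared for equality. *)

(* The triples (i, j, k) with 1 <= i <= m and 1 <= j <= k <= n, stored shifted
   by one as ((i-1, j-1), k-1). *)
Notation tri_pos m n :=
  {p : 'I_m * 'I_n * 'I_n | leq p.1.2 p.2}.

Section InterlacingArrays.

Variables m n : nat.
Implicit Types (p q r : tri_pos m n) (T : {ffun tri_pos m n -> 'I_m}).

Definition pos_block p : 'I_m := (val p).1.1.
Definition pos_col p : 'I_n := (val p).1.2.
Definition pos_row p : 'I_n := (val p).2.

(* h(i,j,k) = i n + j - (n + k)/2 at the 1-based indices (i, j, k) of p. *)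
Definition height p : rat :=
  let i := (pos_block p).+1 in
  let j := (pos_col p).+1 in
  let k := (pos_row p).+1 in
  ((i * n + j)%:R - (n + k)%:R / 2%:R)%R.

(* k.+1 is the 1-based index of the row k. *)
Definition balanced T : bool :=
  [forall k : 'I_n, forall a : 'I_m,
    #|[set p | (pos_row p == k) && (T p == a)]| == k.+1].

Definition interlaced T : bool :=
  [forall p, forall q,
    [&& pos_row p == pos_row q, T p == T q & (height p < height q)%R] ==>
    [exists r, [&& (pos_row r).+1 == pos_row p :> nat, T r == T p,
                   (height p < height r)%R & (height r < height q)%R]]].

Definition has_top_row (lam : 'I_m -> n.-tuple 'I_m) T : bool :=
  [forall p, ((pos_row p).+1 == n) ==>
             (T p == tnth (lam (pos_block p)) (pos_col p))].

Definition interlacing_arrays (lam : 'I_m -> n.-tuple 'I_m) :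
    {set {ffun tri_pos m n -> 'I_m}} :=
  [set T | [&& balanced T, interlaced T & has_top_row lam T]].

End InterlacingArrays.

(* Edges of the square grid graph on the vertices (x, y), 0 <= x, y <= n, with
   base point (0, 0): inl (x, y) is the horizontal edge from (x, y) to
   (x + 1, y), and inr (x, y) the vertical edge from (x, y) to (x, y + 1). *)
Notation grid_edge n := (('I_n * 'I_n.+1) + ('I_n.+1 * 'I_n))%type.

Section GridLabelings.

Variable n : nat.
Implicit Types (f : 'I_n * 'I_n) (L : {ffun grid_edge n -> 'I_4}).

(* The face (x, y) is the unit square with southwest corner (x, y);
   lift ord0 is the successor map 'I_n -> 'I_n.+1. *)
Definition west_edge f : grid_edge n := inr (widen_ord (leqnSn n) f.1, f.2).
Definition south_edge f : grid_edge n := inl (f.1, widen_ord (leqnSn n) f.2).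
Definition east_edge f : grid_edge n := inr (lift ord0 f.1, f.2).
Definition north_edge f : grid_edge n := inl (f.1, lift ord0 f.2).

Definition face_labels L f : seq 'I_4 :=
  [:: L (west_edge f); L (north_edge f); L (east_edge f); L (south_edge f)].

Definition diagonal_face_ok L f : bool := uniq (face_labels L f).

Definition offdiagonal_face_ok L f : bool :=
  (size (undup (face_labels L f)) == 2) &&
  ((L (west_edge f) == L (south_edge f)) && (L (north_edge f) == L (east_edge f))
   || (L (north_edge f) == L (south_edge f)) && (L (west_edge f) == L (east_edge f))).

Definition grid_labeling L : bool :=
  [forall f, if f.1 == f.2 then diagonal_face_ok L f
             else offdiagonal_face_ok L f].

(* The sides in clockwise order from the base point; rev_ord makes the east
   side read top to bottom and the south side right to left. *)
Definition boundary L : 'I_4 -> n.-tuple 'I_4 :=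
  tnth [tuple [tuple L (inr (ord0, j)) | j < n];
              [tuple L (inl (j, ord_max)) | j < n];
              [tuple L (inr (ord_max, rev_ord j)) | j < n];
              [tuple L (inl (rev_ord j, ord0)) | j < n]].

Definition grid_labelings (lam : 'I_4 -> n.-tuple 'I_4) :
    {set {ffun grid_edge n -> 'I_4}} :=
  [set L | grid_labeling L && [forall i, boundary L i == lam i]].

End GridLabelings.

(* Main.v *)
Require Import Defs.
From mathcomp Require Import all_boot all_order all_algebra zify lra.
Set Implicit Arguments.
Unset Strict Implicit.
Unset Printing Implicit Defensive.
Import Order.TTheory GRing.Theory Num.Theory.

(* To a labeling L one associates the array whose row K lists the labels of L
   on the boundary of the K x K subsquare at the base point, clockwise.

   Merge rows K and K+1 of an array by height and read them from left to right,
   keeping the multiset of labels met in row K+1 minus those met in row K.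
   An array is balanced and interlaced exactly when every such multiset is a
   set.  It is empty or a singleton in the first block, has one or two elements
   in the second, and the complements behave symmetrically in the fourth and
   third.  The singletons of the second block are the labels of the vertical
   edges above the diagonal, the complements of the three-element sets of the
   third block those of the horizontal edges below it, and adding a label from
   row K+1 and removing one from row K is the passage through one face. *)

(** Induction on a bound for [#|A|]: delete the highest point [q] of [A] and a point [r] of [B]
    between it and the next highest point [p]. The points that separate the remaining pairs lie
    below [p], hence differ from [r]. *)
Lemma card_separated (I : finType) (h : I -> rat) (A B : {set I}) :
    {in A &, injective h} ->
    (forall p q, p \in A -> q \in A -> (h p < h q)%R ->
       exists2 r, r \in B & (h p < h r < h q)%R) ->
  #|A| <= #|B|.+1.
Proof.
move: {2}#|A| (leqnn #|A|) => N; elim: N A B => [|N IHN] A B.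
  by rewrite leqn0 => /eqP ->.
move=> leAN injh sepAB; have [->|[q0 Aq0]] := set_0Vmem A; first by rewrite cards0.
case: (@arg_maxP _ _ _ q0 (mem A) h Aq0) => q Aq1 max_q1.
have Aq : q \in A by []; have max_q x : x \in A -> (h x <= h q)%R by apply: max_q1.
have [A'0|[p0 A'p0]] := set_0Vmem (A :\ q).
  by rewrite (cardsD1 q) A'0 cards0 addn0; case: (q \in A).
case: (@arg_maxP _ _ _ p0 (mem (A :\ q)) h A'p0) => p A'p1 max_p1.
have A'p : p \in A :\ q by [].
have max_p x : x \in A :\ q -> (h x <= h p)%R by apply: max_p1.
have [neq_pq Ap] : p != q /\ p \in A by apply/andP; rewrite -in_setD1.
have lt_pq : (h p < h q)%R.
  rewrite lt_neqAle max_q // andbT; apply: contra neq_pq => /eqP eq_h.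
  by apply/eqP; apply: injh.
have [r Br /andP[lt_pr lt_rq]] := sepAB p q Ap Aq lt_pq.
rewrite (cardsD1 q A) (cardsD1 r B) Aq Br !add1n ltnS.
apply: (IHN).
- by move: leAN; rewrite (cardsD1 q A) Aq.
- by move=> x y /setD1P[_ Ax] /setD1P[_ Ay]; apply: injh.
move=> x y A'x A'y lt_xy; have [_ Ax] := setD1P A'x; have [_ Ay] := setD1P A'y.
have [s Bs /andP[lt_xs lt_sy]] := sepAB x y Ax Ay lt_xy.
exists s; last by rewrite lt_xs.
rewrite in_setD1 Bs andbT; apply/eqP => eq_sr; move: lt_sy; rewrite eq_sr.
by have := max_p y A'y; lra.
Qed.

Lemma half_shift_lt (R : realFieldType) (x y x' y' : nat) :
  (x%:R - y%:R / 2%:R < x'%:R - y'%:R / 2%:R :> R)%R = (x.*2 + y' < x'.*2 + y).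
Proof.
rewrite -(ltr_nat R) !natrD -!muln2 !natrM.
by apply/idP/idP; lra.
Qed.

(** * Interlacing as inequalities between prefix counts of consecutive rows *)

Section PrefixCounts.

Variables m n : nat.
Implicit Types (p q r : tri_pos m n) (T : {ffun tri_pos m n -> 'I_m}).

Definition before i j p : bool :=
  (pos_block p < i) || (pos_block p == i :> nat) && (pos_col p < j).

(** A block shift of [n] outweighs the column and row offsets, so blocks are compared first. Within
    a block, entry [j] of a row comes just before entry [j] of the row below. *)
Lemma height_lt p q :
    pos_row p <= (pos_row q).+1 -> pos_row q <= (pos_row p).+1 ->
  (height p < height q)%R =
    (pos_block p < pos_block q) || (pos_block p == pos_block q :> nat) &&
      ((pos_col p).*2 + pos_row q < (pos_col q).*2 + pos_row p).
Proof.
move=> kpq kqp.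
have cp : pos_col p <= pos_row p := valP p.
have cq : pos_col q <= pos_row q := valP q.
have kp := ltn_ord (pos_row p); have kq := ltn_ord (pos_row q).
have -> : (height p < height q)%R =
   (((pos_block p).+1 * n).*2 + (pos_col p).*2 + pos_row q <
    ((pos_block q).+1 * n).*2 + (pos_col q).*2 + pos_row p).
  by rewrite /height half_shift_lt; lia.
case: (ltngtP (pos_block p) (pos_block q)) => [lt|lt|->] /=; last by lia.
- by have := leq_mul lt (leqnn n); rewrite !mulSn; lia.
- by have := leq_mul lt (leqnn n); rewrite !mulSn; lia.
Qed.

Lemma pos_inj p q :
  pos_row p = pos_row q -> pos_block p = pos_block q -> pos_col p = pos_col q ->
  p = q.
Proof.
case: p q => [[[i j] k] p] [[[i' j'] k'] q].
rewrite /pos_row /pos_block /pos_col /= => ? ? ?; subst.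
by apply: val_inj.
Qed.

Lemma height_inj p q : pos_row p = pos_row q -> height p = height q -> p = q.
Proof.
move=> eq_k eq_h.
have := height_lt (p := p) (q := q); have := height_lt (p := q) (q := p).
rewrite eq_k leqnSn eq_h ltxx => /(_ isT isT) h1 /(_ isT isT) h2.
apply: pos_inj => //; apply: val_inj => /=; lia.
Qed.

(* Rows are counted from 1 here: K is the number of entries per block, and the
   row K = 0 is empty. *)
Definition prefix_set T K i j a : {set tri_pos m n} :=
  [set p | [&& (pos_row p).+1 == K, T p == a & before i j p]].

Definition prefix_count T K i j a := #|prefix_set T K i j a|.

Lemma prefix_count0 T i j a : prefix_count T 0 i j a = 0.
Proof. by apply: eq_card0 => p; rewrite inE. Qed.

Lemma prefix_count_start T K a : prefix_count T K 0 0 a = 0.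
Proof. by apply: eq_card0 => p; rewrite inE /before !ltn0 !andbF. Qed.

Lemma prefix_count_block T K i a :
  prefix_count T K i.+1 0 a = prefix_count T K i K a.
Proof.
apply: eq_card => p; rewrite !inE /before; case: eqP => //= <-.
by have : pos_col p <= pos_row p := valP p; case: (T p == a) => //=; lia.
Qed.

Lemma prefix_count_step T p a :
  prefix_count T (pos_row p).+1 (pos_block p) (pos_col p).+1 a =
  prefix_count T (pos_row p).+1 (pos_block p) (pos_col p) a + (T p == a).
Proof.
rewrite /prefix_count (cardsD1 p) addnC !inE /before !eqxx ltnSn orbT andbT /=.
congr (_ + _); apply: eq_card => q; rewrite !inE /before !eqSS.
have [->|neq_qp] /= := eqVneq q p; first by rewrite !ltnn !andbF.
case: eqP => //= eq_k; case: (T q == a) => //=.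
case: (ltngtP (pos_block q) (pos_block p)) => //= eq_b.
rewrite ltnS leq_eqVlt orbC; case: ltnP => //= _; apply: contra_neqF neq_qp.
by move/eqP => eq_c; apply: pos_inj; apply: val_inj.
Qed.

Lemma prefix_count_mono T K i j i' j' a :
    (i < i') || (i == i') && (j <= j') ->
  prefix_count T K i j a <= prefix_count T K i' j' a.
Proof.
move=> le_ij; apply/subset_leq_card/subsetP => p; rewrite !inE /before.
by case/and3P => -> -> /= ; lia.
Qed.

Lemma prefix_count_total T K a :
  prefix_count T K m 0 a = #|[set p | ((pos_row p).+1 == K) && (T p == a)]|.
Proof. by apply: eq_card => p; rewrite !inE /before ltn_ord andbT. Qed.

Lemma balancedP T :
  reflect (forall K, K <= n -> forall a, prefix_count T K m 0 a = K) (balanced T).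
Proof.
apply: (iffP forallP) => [balT [|k] lt_kn a | balT k].
- exact: prefix_count0.
- by have /forallP/(_ a)/eqP := balT (Ordinal lt_kn); rewrite prefix_count_total.
by apply/forallP => a; rewrite -[X in _ == X](balT k.+1 _ a) // prefix_count_total.
Qed.

(** In the merged reading, the excess of [a] in row [k.+1] is locally least just before an entry of
    that row and locally greatest just after it. Testing these two places confines the excess to 0
    and 1. *)
Lemma prefix_count_bounds T k i j a :
    balanced T -> interlaced T -> k < n ->
  (prefix_count T k i j a <= prefix_count T k.+1 i j a) *
  (prefix_count T k.+1 i j.+1 a <= (prefix_count T k i j a).+1).
Proof.
move=> /balancedP balT intT lt_kn.
have sep p q : pos_row p = k :> nat -> pos_row q = k :> nat -> T p = a -> T q = a ->
    (height p < height q)%R ->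
    exists r, [/\ (pos_row r).+1 = k, T r = a, before (pos_block r) (pos_col r).+1 p,
        before (pos_block q) (pos_col q) r & (height p < height r < height q)%R].
  move=> kp kq Tp Tq lt_pq.
  have /existsP[r /and4P[/eqP kr /eqP Tr lt_pr lt_rq]] :
      [exists r, [&& (pos_row r).+1 == pos_row p :> nat, T r == T p,
                   (height p < height r)%R & (height r < height q)%R]].
    move/forallP/(_ p)/forallP/(_ q)/implyP: intT; apply.
    by rewrite Tp Tq lt_pq eqxx !andbT; apply/eqP; apply: val_inj; rewrite /= kp.
  exists r; rewrite Tr Tp kr kp lt_pr lt_rq; split=> //.
  - by move: lt_pr; rewrite height_lt /before; lia.
  - by move: lt_rq; rewrite height_lt /before; lia.
have injA (A : {set tri_pos m n}) : (forall p, p \in A -> pos_row p = k :> nat) ->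
    {in A &, injective (@height m n)}.
  by move=> rowA p q Ap Aq; apply: height_inj; apply: val_inj; rewrite /= !rowA.
split; last first.
  apply: (@card_separated _ (@height m n)) => [|p q].
    by apply: injA => p; rewrite inE => /and3P[/eqP[->]].
  rewrite !inE => /and3P[/eqP[kp] /eqP Tp _] /and3P[/eqP[kq] /eqP Tq bef_q] lt_pq.
  have [r [kr Tr bef_pr bef_rq lt_pqr]] := sep p q kp kq Tp Tq lt_pq.
  exists r => //; rewrite inE kr Tr !eqxx; move: bef_rq bef_q; rewrite /before; lia.
have compl K : K <= n -> prefix_count T K i j a +
    #|[set p | [&& (pos_row p).+1 == K, T p == a & ~~ before i j p]]| = K.
  move=> le_Kn; rewrite -[RHS](balT K le_Kn a) prefix_count_total.
  rewrite -(cardsID [set p | before i j p] [set p | _ && (T p == a)]).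
  congr (_ + _); apply: eq_card => p; rewrite !inE -?andbA //.
  by rewrite [RHS]andbC -andbA.
(* Balance fixes the totals [k] and [k.+1], so the lower bound for prefixes is an upper bound for
   the complementary suffixes. *)
suff : #|[set p | [&& (pos_row p).+1 == k.+1, T p == a & ~~ before i j p]]| <=
       #|[set p | [&& (pos_row p).+1 == k, T p == a & ~~ before i j p]]|.+1.
  by have := compl _ lt_kn; have := compl _ (ltnW lt_kn); lia.
apply: (@card_separated _ (@height m n)) => [|p q].
  by apply: injA => p; rewrite inE => /and3P[/eqP[->]].
rewrite !inE => /and3P[/eqP[kp] /eqP Tp bef_p] /and3P[/eqP[kq] /eqP Tq _] lt_pq.
have [r [kr Tr bef_pr bef_rq lt_pqr]] := sep p q kp kq Tp Tq lt_pq.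
exists r => //; rewrite inE kr Tr !eqxx; move: bef_pr bef_p; rewrite /before; lia.
Qed.

(** The bounds force both rows to hold equally many copies of the label just before [p], and again
    just before [q]. The upper row gains a copy at [p], so the lower row gains one in between. *)
Lemma interlaced_of_bounds T :
    (forall k i j a, k < n -> i < m -> j <= k ->
      (prefix_count T k i j a <= prefix_count T k.+1 i j a) *
      (prefix_count T k.+1 i j.+1 a <= (prefix_count T k i j a).+1)) ->
  interlaced T.
Proof.
move=> bounds; apply/forallP => p; apply/forallP => q; apply/implyP.
move=> /and3P[/eqP eq_k /eqP eq_T lt_pq].
have bef_pq : before (pos_block q) (pos_col q) p.
  by move: lt_pq; rewrite height_lt /before eq_k //; lia.
have cp : pos_col p <= pos_row p := valP p.
have cq : pos_col q <= pos_row q := valP q.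
(* Prefix counts number rows from 1, so row [pos_row p] is the one below that of [p]. *)
have [_ up_p] := bounds _ _ _ (T p) (ltn_ord _) (ltn_ord (pos_block p)) cp.
have [lo_p _] := bounds _ _ _ (T p) (ltn_ord _) (ltn_ord (pos_block p)) cp.
have [lo_q up_q] := bounds _ _ _ (T p) (ltn_ord _) (ltn_ord (pos_block q)) cq.
move: up_p up_q; rewrite !prefix_count_step eq_T eqxx -eq_T => up_p up_q.
have : prefix_count T (pos_row p).+1 (pos_block p) (pos_col p).+1 (T p) <=
       prefix_count T (pos_row p).+1 (pos_block q) (pos_col q) (T p).
  by apply: prefix_count_mono; move: bef_pq; rewrite /before; lia.
rewrite prefix_count_step eqxx eq_k => mono.
have /subsetPn[r] : ~~ (prefix_set T (pos_row p) (pos_block q) (pos_col q) (T p)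
   \subset prefix_set T (pos_row p) (pos_block p) (pos_col p) (T p)).
  apply/negP => /subset_leq_card; rewrite -!/(prefix_count _ _ _ _ _).
  by move: up_p up_q lo_p lo_q mono; rewrite eq_k; lia.
rewrite !inE => /and3P[/eqP kr /eqP Tr bef_r] /=.
rewrite kr Tr !eqxx /= => nbef_r.
apply/existsP; exists r; rewrite kr Tr !eqxx /=.
by rewrite !height_lt; move: bef_r nbef_r kr; rewrite /before eq_k; lia.
Qed.

End PrefixCounts.

(** Allows indexing by natural numbers instead of ordinals, so that index arithmetic carries no
    bound proofs; [x0] is the value outside the range of [key]. *)
Definition lookup (I : finType) (K : eqType) (A : Type) (x0 : A)
    (key : I -> K) (f : I -> A) (c : K) : A :=
  if [pick x | key x == c] is Some x then f x else x0.

Lemma lookupK (I : finType) (K : eqType) (A : Type) (x0 : A)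
    (key : I -> K) (f : I -> A) x :
  injective key -> lookup x0 key f (key x) = f x.
Proof.
rewrite /lookup => inj_key; case: pickP => [y /eqP/inj_key -> //|].
by move/(_ x); rewrite eqxx.
Qed.

Definition jump_label (f g : 'I_4 -> nat) : 'I_4 :=
  odflt ord0 [pick a | g a != f a].

(** Unequal sums force a jump, so the default [ord0] does not occur; a difference of one leaves no
    room for a second jump. *)
Lemma jump_labelP (f g : 'I_4 -> nat) :
    (forall a, f a <= g a <= (f a).+1) -> \sum_a g a = (\sum_a f a).+1 ->
  forall a, g a = f a + (jump_label f g == a).
Proof.
move=> fg sum_fg; rewrite /jump_label; case: pickP => [b ne_b|eq_fg] /=; last first.
  have : \sum_a g a = \sum_a f a by apply: eq_bigr => a _; apply/eqP/negbFE/eq_fg.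
  by lia.
move=> a; have [<-|ne_ba] := eqVneq; first by have := fg b; lia.
have split2 F : \sum_c F c = F b + (F a + \sum_(c < 4 | (c != b) && (c != a)) F c) :> nat.
  by rewrite (bigD1 b) //= [X in _ + X](bigD1 a) // eq_sym.
move: sum_fg; rewrite !split2; have := fg a; have := fg b.
have : \sum_(i < 4 | (i != b) && (i != a)) f i <= \sum_(i < 4 | (i != b) && (i != a)) g i.
  by apply: leq_sum => i _; case/andP: (fg i).
by lia.
Qed.

(** * Array entries at natural-number indices and sizes of prefixes *)

Section ArrayEntries.

Variable n : nat.
Implicit Types (T : {ffun tri_pos 4 n -> 'I_4}).

Definition tri_key (p : tri_pos 4 n) : nat * nat * nat :=
  (nat_of_ord (pos_block p), nat_of_ord (pos_col p), (pos_row p).+1).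

Lemma tri_key_inj : injective tri_key.
Proof. by move=> p q [eq_b eq_c eq_k]; apply: pos_inj; apply: val_inj. Qed.

Definition entry T i j K : 'I_4 := lookup ord0 tri_key T (i, j, K).

Lemma entryE T p : entry T (pos_block p) (pos_col p) (pos_row p).+1 = T p.
Proof. exact: (lookupK _ _ _ tri_key_inj). Qed.

Lemma tri_pos_ex i j K : i < 4 -> j < K -> K <= n ->
  exists p : tri_pos 4 n, [/\ pos_block p = i :> nat, pos_col p = j :> nat &
    (pos_row p).+1 = K].
Proof.
move=> lt_i; case: K => // k; rewrite ltnS => le_jk lt_kn.
pose p := (Ordinal lt_i, Ordinal (leq_ltn_trans le_jk lt_kn), Ordinal lt_kn).
by exists (exist (fun p : 'I_4 * 'I_n * 'I_n => p.1.2 <= p.2) p le_jk).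
Qed.

Lemma prefix_count_entry T i j K a : i < 4 -> j < K -> K <= n ->
  prefix_count T K i j.+1 a = prefix_count T K i j a + (entry T i j K == a).
Proof.
move=> lt_i lt_jK le_Kn; have [p [<- <- <-]] := tri_pos_ex lt_i lt_jK le_Kn.
by rewrite entryE prefix_count_step.
Qed.

(** Each position read contributes to exactly one label. Differences of these sums are the sizes of
    the multisets in the merged reading. *)
Lemma sum_prefix_count T i j K : i < 4 -> j <= K -> K <= n ->
  \sum_a prefix_count T K i j a = i * K + j.
Proof.
move=> lt_i le_jK le_Kn.
have sum_col i' : i' < 4 -> \sum_a prefix_count T K i' 0 a = i' * K ->
    forall j', j' <= K -> \sum_a prefix_count T K i' j' a = i' * K + j'.
  move=> lt_i' sum0; elim=> [|j' IHj] lt_j'; first by rewrite addn0.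
  under eq_bigr do rewrite prefix_count_entry //.
  have one (b : 'I_4) : \sum_a (b == a) = 1.
    by rewrite (bigD1 b) //= eqxx big1 // => a; rewrite eq_sym => /negbTE ->.
  by rewrite big_split /= IHj 1?ltnW // one; lia.
apply: (sum_col) => //; elim: i lt_i {j le_jK} => [|i IHi] lt_i.
  by rewrite big1 // => a _; apply: prefix_count_start.
under eq_bigr do rewrite prefix_count_block.
by rewrite sum_col ?mulSn 1?addnC // 1?ltnW // IHi // ltnW.
Qed.

End ArrayEntries.

(** * Face conditions as label counts *)

Lemma uniq4P (w x y z : 'I_4) :
  reflect (forall a, (w == a) + (x == a) + (y == a) + (z == a) = 1)
          (uniq [:: w; x; y; z]).
Proof.
apply: (iffP idP) => [Us a|one].
  have : a \in [:: w; x; y; z].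
    have /subset_cardP/(_ (subset_predT _)) -> // : #|[:: w; x; y; z]| = #|'I_4|.
    by rewrite (card_uniqP Us) card_ord.
  by move=> as_; have := count_uniq_mem a Us; rewrite as_ /=; lia.
rewrite /= !inE !negb_or; have := one w; have := one x; have := one y.
by rewrite !eqxx !(eq_sym _ w) !(eq_sym _ x) (eq_sym z y); lia.
Qed.

(** Both alternatives say that west and north carry the same two-element set as east and south. In
    this additive form a face can be crossed by linear arithmetic. *)
Lemma offdiagonalP (w x y z : 'I_4) :
  reflect (forall a, (w == a) + (x == a) = (y == a) + (z == a) /\
                     (w == a) + (x == a) <= 1)
    ((size (undup [:: w; x; y; z]) == 2) &&
     ((w == z) && (x == y) || (x == z) && (w == y))).
Proof.
have le1 a : w != x -> (w == a) + (x == a) <= 1.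
  by case: (eqVneq w a) => [<-|_ _]; [rewrite eq_sym => /negbTE -> | case: (x == a)].
apply: (iffP idP) => [/andP[sz eqs] a | two].
  have ne_wx : w != x.
    apply: contraTneq sz => eq_wx; move: eqs; rewrite -eq_wx.
    by case/orP=> /andP[/eqP <- /eqP <-]; rewrite /= !inE !eqxx.
  split; last exact: le1.
  by case/orP: eqs => /andP[/eqP <- /eqP <-]; rewrite // addnC.
have [two_w le_w] := two w; have [two_x le_x] := two x.
move: two_w le_w two_x le_x; rewrite !eqxx (eq_sym x).
case: (eqVneq w x) => // ne_wx + _.
have [->|_] := eqVneq y w; have [->|_] := eqVneq z w => //=.
  rewrite (negbTE ne_wx); case: (eqVneq z x) => // -> _ _ _.
  by rewrite !inE !eqxx !orbT /= (negbTE ne_wx).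
rewrite (negbTE ne_wx) addn0; case: (eqVneq y x) => // -> _ _ _.
by rewrite !inE !eqxx !orbT /= (eq_sym x) (negbTE ne_wx).
Qed.

(** * Edges at natural-number coordinates and boundaries of subsquares *)

Section GridEdges.

Variable n : nat.
Implicit Types (L : {ffun grid_edge n -> 'I_4}).

Definition nat_pair r s (e : 'I_r * 'I_s) : nat * nat :=
  (nat_of_ord e.1, nat_of_ord e.2).

Lemma nat_pair_inj r s : injective (@nat_pair r s).
Proof. by move=> [x y] [x' y'] [/= ? ?]; congr pair; apply: val_inj. Qed.

Definition hedge L x y : 'I_4 :=
  lookup ord0 (@nat_pair n n.+1) (fun e => L (inl e)) (x, y).
Definition vedge L x y : 'I_4 :=
  lookup ord0 (@nat_pair n.+1 n) (fun e => L (inr e)) (x, y).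

Lemma hedgeE L (e : 'I_n * 'I_n.+1) : hedge L e.1 e.2 = L (inl e).
Proof. exact: (lookupK _ _ _ (@nat_pair_inj _ _)). Qed.
Lemma vedgeE L (e : 'I_n.+1 * 'I_n) : vedge L e.1 e.2 = L (inr e).
Proof. exact: (lookupK _ _ _ (@nat_pair_inj _ _)). Qed.

Definition face_rule L x y a : Prop :=
  let w := vedge L x y == a in let u := hedge L x y.+1 == a in
  let e := vedge L x.+1 y == a in let s := hedge L x y == a in
  if x == y then w + u + e + s = 1 else w + u = e + s /\ w + u <= 1.

Lemma grid_labelingP L :
  reflect (forall x y a, x < n -> y < n -> face_rule L x y a) (grid_labeling L).
Proof.
have faceE f : face_labels L f =
    [:: vedge L f.1 f.2; hedge L f.1 f.2.+1; vedge L f.1.+1 f.2; hedge L f.1 f.2].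
  rewrite /face_labels -[L (west_edge f)]vedgeE -[L (east_edge f)]vedgeE.
  by rewrite -[L (south_edge f)]hedgeE -[L (north_edge f)]hedgeE /=.
have ruleP (f : 'I_n * 'I_n) : reflect (forall a, face_rule L f.1 f.2 a)
    (if f.1 == f.2 then diagonal_face_ok L f else offdiagonal_face_ok L f).
  rewrite /face_rule -val_eqE /diagonal_face_ok /offdiagonal_face_ok faceE.
  case: ifP => _; first exact: uniq4P.
  case: (faceE f) => -> -> -> ->; exact: offdiagonalP.
apply: (iffP forallP) => [ok x y a ltx lty | ok f].
  exact: (ruleP (Ordinal ltx, Ordinal lty) (ok _)).
by apply/ruleP => a; apply: ok.
Qed.

Lemma grid_eqP L L' :
    (forall x y, x < n -> y <= n -> hedge L x y = hedge L' x y) ->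
    (forall x y, x <= n -> y < n -> vedge L x y = vedge L' x y) ->
  L = L'.
Proof.
move=> eqh eqv; apply/ffunP => -[e|e].
  by rewrite -!hedgeE eqh // -ltnS ltn_ord.
by rewrite -!vedgeE eqv // -ltnS ltn_ord.
Qed.

(** East and south are read backwards, hence [K - j.+1]; the subtraction is exact for [j < K]. *)
Definition subsquare_boundary L i j K : 'I_4 :=
  match i with
  | 0 => vedge L 0 j
  | 1 => hedge L j K
  | 2 => vedge L K (K - j.+1)
  | _ => hedge L (K - j.+1) 0
  end.

Definition array_of_grid L : {ffun tri_pos 4 n -> 'I_4} :=
  [ffun p => subsquare_boundary L (pos_block p) (pos_col p) (pos_row p).+1].

Lemma entry_array_of_grid L i j K : i < 4 -> j < K -> K <= n ->
  entry (array_of_grid L) i j K = subsquare_boundary L i j K.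
Proof.
move=> lt_i lt_jK le_Kn; have [p [<- <- <-]] := tri_pos_ex lt_i lt_jK le_Kn.
by rewrite entryE ffunE.
Qed.

Lemma boundary_array_of_grid L lam :
  [forall i, boundary L i == lam i] = has_top_row lam (array_of_grid L).
Proof.
have bE (i : 'I_4) (j : 'I_n) : tnth (boundary L i) j = subsquare_boundary L i j n.
  case: i => -[|[|[|[|//]]]] lt_i.
  - by rewrite -[LHS]/(tnth [tuple L (inr (ord0, y)) | y < n] j) tnth_mktuple -vedgeE.
  - by rewrite -[LHS]/(tnth [tuple L (inl (x, ord_max)) | x < n] j) tnth_mktuple -hedgeE.
  - rewrite -[LHS]/(tnth [tuple L (inr (ord_max, rev_ord y)) | y < n] j).
    by rewrite tnth_mktuple -vedgeE.
  - rewrite -[LHS]/(tnth [tuple L (inl (rev_ord x, ord0)) | x < n] j).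
    by rewrite tnth_mktuple -hedgeE.
apply/forallP/forallP => [eq_b p | top i].
  apply/implyP => /eqP eq_n; rewrite ffunE -(eqP (eq_b _)) bE eq_n //.
apply/eqP/eq_from_tnth => j; rewrite bE.
have lt_jn := ltn_ord j.
have [p [pi pj pk]] := tri_pos_ex (ltn_ord i) (ltn_ord j) (leqnn n).
have /implyP/(_ (introT eqP pk))/eqP := top p.
by rewrite ffunE (val_inj pi) (val_inj pj) pk.
Qed.

End GridEdges.

(** * From labelings to arrays: the merged reading crosses the faces between two nested
    subsquares *)

Section GridToArray.

Variables (n : nat) (L : {ffun grid_edge n -> 'I_4}).
Hypothesis gridL : grid_labeling L.

Let T := array_of_grid L.
Let C := prefix_count T.

Let face x y a : x < n -> y < n -> face_rule L x y a.
Proof. by move=> ltx lty; apply: (elimT (grid_labelingP L) gridL). Qed.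

Let step i j K a : i < 4 -> j < K -> K <= n ->
  C K i j.+1 a = C K i j a + (subsquare_boundary L i j K == a).
Proof. by move=> *; rewrite /C prefix_count_entry // entry_array_of_grid. Qed.

Lemma count_diff_west k j a : k < n -> j <= k -> C k.+1 0 j a = C k 0 j a.
Proof.
move=> lt_kn; elim: j => [|j IHj] lt_jk; first by rewrite /C !prefix_count_start.
by rewrite !step ?IHj //=; lia.
Qed.

(** Passing from [j] to [j.+1] crosses the face [(j, k)]: its north label enters, its south label
    leaves, and the face rule turns the west label into the east one. *)
Lemma count_diff_north k j a : k < n -> j <= k ->
  C k.+1 1 j a = C k 1 j a + (vedge L j k == a).
Proof.
move=> lt_kn; elim: j => [|j IHj] lt_jk.
  rewrite /C !prefix_count_block -!/(C _ _ _ _) step ?count_diff_west //.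
have := @face j k a; rewrite /face_rule ltn_eqF // => /(_ _ lt_kn) [|two _]; first by lia.
by rewrite !step ?IHj //=; lia.
Qed.

(** The set is described by its complement, the east and south labels of the face [(k, k - j)]. *)
Lemma count_diff_east k j a : k < n -> j <= k ->
  C k.+1 2 j a + (vedge L k.+1 (k - j) == a) + (hedge L k (k - j) == a) =
  (C k 2 j a).+1.
Proof.
move=> lt_kn; elim: j => [|j IHj] lt_jk.
  (* At the corner the set holds the west and north labels of the diagonal face [(k, k)], whose four
     labels are distinct. *)
  rewrite /C !prefix_count_block -!/(C _ _ _ _) step ?count_diff_north //= subn0.
  by have := @face k k a lt_kn lt_kn; rewrite /face_rule eqxx; lia.
have := @face k (k - j.+1) a; rewrite /face_rule gtn_eqF; last by lia.
case=> [||two _]; rewrite ?subnSK //; try lia.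
have -> : C k 2 j.+1 a = C k 2 j a + (vedge L k (k - j.+1) == a) by rewrite step //=; lia.
have -> : C k.+1 2 j.+1 a = C k.+1 2 j a + (vedge L k.+1 (k - j) == a).
  by rewrite step //= ?subSS //; lia.
by have := IHj (ltnW lt_jk); move: two; rewrite subnSK //; lia.
Qed.

(** Read right to left, the larger south side is one extra edge followed by the smaller side, so the
    missing label is the next one to be read in row [k.+1]. *)
Lemma count_diff_south k j a : k < n -> j <= k ->
  C k.+1 3 j a + (hedge L (k - j) 0 == a) = (C k 3 j a).+1.
Proof.
move=> lt_kn; elim: j => [|j IHj] lt_jk.
  rewrite /C !prefix_count_block -!/(C _ _ _ _) step //= subSS.
  by have := @count_diff_east k k a lt_kn (leqnn k); rewrite subnn subn0.
have := IHj (ltnW lt_jk); rewrite !step //= ?subSS; lia.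
Qed.

Lemma count_diff_end k a : k < n -> C k.+1 4 0 a = (C k 4 0 a).+1.
Proof.
move=> lt_kn; rewrite /C !prefix_count_block -!/(C _ _ _ _) step //= subSS.
exact: count_diff_south.
Qed.

Lemma balanced_array_of_grid : balanced T.
Proof.
apply/balancedP; elim=> [_ a|k IHk lt_kn a]; first exact: prefix_count0.
by rewrite -/(C _ _ _ _) count_diff_end // /C IHk // ltnW.
Qed.

(** In the two middle blocks the bounds come down to distinct west and north labels, or distinct
    east and south labels, of a face. *)
Lemma interlaced_array_of_grid : interlaced T.
Proof.
apply: interlaced_of_bounds => k i j a lt_kn lt_i4 le_jk; rewrite -!/(C _ _ _ _).
rewrite step //; case: i lt_i4 => [|[|[|[|//]]]] _ /=.
- by rewrite count_diff_west //; case: (_ == a); split; lia.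
- rewrite count_diff_north //.
  have := @face j k a (leq_ltn_trans le_jk lt_kn) lt_kn; rewrite /face_rule.
  by case: ifP => _; split; lia.
- have := @count_diff_east k j a lt_kn le_jk; rewrite subSS.
  have := @face k (k - j) a lt_kn (leq_ltn_trans (leq_subr _ _) lt_kn).
  rewrite /face_rule.
  by case: ifP => _; split; lia.
- have := @count_diff_south k j a lt_kn le_jk; rewrite subSS.
  by case: (_ == a); split; lia.
Qed.

End GridToArray.

Lemma eq_of_leq_sum (f g : 'I_4 -> nat) :
  (forall a, f a <= g a) -> \sum_a g a = \sum_a f a -> forall a, f a = g a.
Proof.
move=> le_fg + a.
have split1 F : \sum_b F b = F a + \sum_(b < 4 | b != a) F b :> nat by rewrite (bigD1 a).
rewrite !split1.
have : \sum_(i < 4 | i != a) f i <= \sum_(i < 4 | i != a) g i by apply: leq_sum.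
by have := le_fg a; lia.
Qed.

Lemma label_eq (x y : 'I_4) : (forall a, (x == a) = (y == a) :> nat) -> x = y.
Proof. by move=> /(_ x); rewrite eqxx; case: eqP. Qed.

(** * From arrays to labelings: edge labels recovered from prefix counts *)

Section ArrayToGrid.

Variables (n : nat) (T : {ffun tri_pos 4 n -> 'I_4}).

Let C := prefix_count T.

Definition vstate x y : 'I_4 := jump_label (C y 1 x) (C y.+1 1 x).
(** The complement of a three-element set: adding one to every count of the lower row makes the
    missing label a jump. *)
Definition hstate x y : 'I_4 :=
  jump_label (C x.+1 2 (x - y).+1) (fun a => (C x 2 (x - y) a).+1).

(** Horizontal edges with [x < y] lie on the north side of a subsquare and vertical edges with
    [y < x] on an east side. Agreement with blocks 0 and 3 is the content of [entry_west] and
    [entry_south]. *)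
Definition grid_of_array : {ffun grid_edge n -> 'I_4} :=
  [ffun e : grid_edge n => match e with
   | inl (x, y) => if x < y then entry T 1 x y else hstate x y
   | inr (x, y) => if y < x then entry T 2 (x - y.+1) x else vstate x y
   end].

Lemma hedge_grid_of_array x y : x < n -> y <= n ->
  hedge grid_of_array x y = if x < y then entry T 1 x y else hstate x y.
Proof.
move=> ltx ley; pose e := (Ordinal ltx, Ordinal (ley : y < n.+1)).
by rewrite -[x]/(nat_of_ord e.1) -[y]/(nat_of_ord e.2) hedgeE ffunE.
Qed.

Lemma vedge_grid_of_array x y : x <= n -> y < n ->
  vedge grid_of_array x y = if y < x then entry T 2 (x - y.+1) x else vstate x y.
Proof.
move=> lex lty; pose e := (Ordinal (lex : x < n.+1), Ordinal lty).
by rewrite -[x]/(nat_of_ord e.1) -[y]/(nat_of_ord e.2) vedgeE ffunE.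
Qed.

Hypotheses (balT : balanced T) (intT : interlaced T).

Let bound k i j a : k < n ->
  (C k i j a <= C k.+1 i j a) * (C k.+1 i j.+1 a <= (C k i j a).+1).
Proof. exact: prefix_count_bounds. Qed.

Let step i j K a : i < 4 -> j < K -> K <= n ->
  C K i j.+1 a = C K i j a + (entry T i j K == a).
Proof. exact: prefix_count_entry. Qed.

Lemma vstateP x y a : x <= y -> y < n ->
  C y.+1 1 x a = C y 1 x a + (vstate x y == a).
Proof.
move=> le_xy lt_yn; apply: (@jump_labelP (C y 1 x) (C y.+1 1 x)) => [b|].
  have [-> up] /= := bound 1 x b lt_yn; apply: leq_trans up.
  by apply: prefix_count_mono; rewrite eqxx leqnSn orbT.
rewrite /C !sum_prefix_count //; lia.
Qed.

(** The prefix sizes are [2 * x + (x - y)], plus one for each of four labels, against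
    [2 * x.+1 + (x - y).+1]: one label jumps. *)
Lemma hstateP x y a : y <= x -> x < n ->
  (C x 2 (x - y) a).+1 = C x.+1 2 (x - y).+1 a + (hstate x y == a).
Proof.
move=> le_yx lt_xn.
apply: (@jump_labelP (C x.+1 2 (x - y).+1) (fun b => (C x 2 (x - y) b).+1)) => [b|].
  have [lo ->] /= := bound 2 (x - y) b lt_xn; rewrite ltnS; apply: leq_trans lo _.
  by apply: prefix_count_mono; rewrite eqxx leqnSn orbT.
under eq_bigr do rewrite -addn1.
by rewrite big_split /= sum_nat_const card_ord /C !sum_prefix_count //; lia.
Qed.

(** Equal prefix sizes turn the lower bounds into equalities, so block 0 of each row extends that of
    the row below. It remains to treat row [j.+1], where the entry ends its block. *)
Lemma entry_west j K : j < K -> K <= n -> entry T 0 j K = vstate 0 j.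
Proof.
have count k i a : k < n -> i <= k -> C k.+1 0 i a = C k 0 i a.
  move=> lt_kn le_ik; symmetry; apply: (eq_of_leq_sum (f := C k 0 i)).
    by move=> b; case: (bound 0 i b lt_kn).
  by rewrite /C !sum_prefix_count //; lia.
elim: K => // k IHk; rewrite ltnS leq_eqVlt => /orP[/eqP -> | lt_jk] lt_kn.
  apply: label_eq => a; have := vstateP a (leq0n k) lt_kn.
  by rewrite /C !prefix_count_block -!/(C _ _ _ _) step // count //; lia.
rewrite -IHk // 1?ltnW //; apply: label_eq => a.
by have := count k j.+1 a lt_kn lt_jk; rewrite !step // ?count //; lia.
Qed.

(** The prefix sizes differ by four, so all four upper bounds are equalities. Hence entry [j.+1] of
    row [k.+1] repeats entry [j] of row [k], which leads back to [j = 0]. *)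
Lemma entry_south j K : j < K -> K <= n -> entry T 3 j K = hstate (K - j.+1) 0.
Proof.
have count k i a : k < n -> i <= k -> C k.+1 3 i.+1 a = (C k 3 i a).+1.
  move=> lt_kn le_ik.
  apply: (@eq_of_leq_sum (C k.+1 3 i.+1) (fun b => (C k 3 i b).+1)) => [b|].
    by case: (bound 3 i b lt_kn).
  under eq_bigr do rewrite -addn1.
  by rewrite big_split /= sum_nat_const card_ord /C !sum_prefix_count //; lia.
elim: j K => [|j IHj] [//|k] lt_jk lt_kn; rewrite subSS.
  apply: label_eq => a; have := hstateP a (leq0n k) lt_kn.
  have := count k 0 a lt_kn (leq0n k).
  by rewrite subn0 step // /C !prefix_count_block; lia.
rewrite -IHj // 1?ltnW //; apply: label_eq => a.
have := count k j.+1 a lt_kn lt_jk.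
have := count k j a lt_kn; rewrite !step //; lia.
Qed.

Lemma grid_of_arrayK : array_of_grid grid_of_array = T.
Proof.
apply/ffunP => p; rewrite ffunE -[RHS]entryE.
have : pos_col p < (pos_row p).+1 := valP p.
move: (pos_block p : nat) (ltn_ord (pos_block p)) (pos_col p : nat) => i lt_i j.
have := ltn_ord (pos_row p); move: (pos_row p : nat).+1 => K le_Kn lt_jK.
have lt_jn := leq_trans lt_jK le_Kn.
case: i lt_i => [|[|[|[|//]]]] _ /=.
- by rewrite vedge_grid_of_array // entry_west.
- by rewrite hedge_grid_of_array // lt_jK.
- rewrite vedge_grid_of_array ?ifT //; try lia.
  by congr entry; lia.
- by rewrite hedge_grid_of_array ?ltn0 ?entry_south //; lia.
Qed.

Lemma grid_labeling_grid_of_array : grid_labeling grid_of_array.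
Proof.
apply/grid_labelingP => x y a lt_xn lt_yn.
have [le_xn le_yn] := (ltnW lt_xn, ltnW lt_yn).
rewrite /face_rule !hedge_grid_of_array ?vedge_grid_of_array // !ltnS.
have [lt_xy|lt_yx|<-] := ltngtP x y.
(* West plus north and east plus south both count [C y.+1 1 x.+1 a - C y 1 x a]. *)
- have [_ +] := bound 1 x a lt_yn; have := vstateP a lt_xy lt_yn.
  by have := vstateP a (ltnW lt_xy) lt_yn; rewrite !step //; lia.
(* Here both pairs count [(C x 2 (x - y) a).+1 - C x.+1 2 (x - y) a]. *)
- rewrite subSS.
  have [+ _] := bound 2 (x - y) a lt_xn; have := hstateP a lt_yx lt_xn.
  have := hstateP a (ltnW lt_yx) lt_xn; rewrite -(subnSK lt_yx) !step //; lia.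
(* West and north count [C x.+1 2 0 a - C x 2 0 a]; east and south count one minus this. *)
- rewrite subnn.
  have := vstateP a (leqnn x) lt_xn; have := hstateP a (leqnn x) lt_xn.
  by rewrite subnn step // /C !prefix_count_block -!/(C _ _ _ _) step //; lia.
Qed.

End ArrayToGrid.

(** Some edges are array entries. For the others, [count_diff_north] and [count_diff_east] exhibit
    the label of [L] as the jump that defines [vstate] or [hstate]. *)
Lemma array_of_gridK n (L : {ffun grid_edge n -> 'I_4}) :
  grid_labeling L -> grid_of_array (array_of_grid L) = L.
Proof.
move=> gridL; have balT := balanced_array_of_grid gridL.
have intT := interlaced_array_of_grid gridL.
apply: grid_eqP => x y.
  move=> lt_xn le_yn; rewrite hedge_grid_of_array //.
  case: ltnP => [lt_xy|le_yx]; first exact: entry_array_of_grid.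
  apply: label_eq => a; have := hstateP balT intT a le_yx lt_xn.
  have := count_diff_east gridL a lt_xn (leq_subr y x).
  rewrite prefix_count_entry ?entry_array_of_grid ?ltnS ?leq_subr //= subSS subKn //.
  by lia.
move=> le_xn lt_yn; rewrite vedge_grid_of_array //.
case: ltnP => [lt_yx|le_xy].
  by rewrite entry_array_of_grid //=; [congr vedge; lia | lia].
apply: label_eq => a; have := vstateP balT intT a le_xy lt_yn.
by rewrite (count_diff_north gridL) //; lia.
Qed.

Theorem theorem1p4 (n : nat) (hn : 1 <= n) (lam : 'I_4 -> n.-tuple 'I_4) :
  exists phi : {T : {ffun tri_pos 4 n -> 'I_4} | T \in interlacing_arrays lam} ->
               {L : {ffun grid_edge n -> 'I_4} | L \in grid_labelings lam},
    bijective phi.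
Proof.
have inT (L : {L | L \in grid_labelings lam}) :
    array_of_grid (val L) \in interlacing_arrays lam.
  have := valP L; rewrite !inE boundary_array_of_grid => /andP[gridL ->].
  by rewrite balanced_array_of_grid ?interlaced_array_of_grid.
have inL (T : {T | T \in interlacing_arrays lam}) :
    grid_of_array (val T) \in grid_labelings lam.
  (* The boundary of the labeling is the top row of its array, which is [T] again. *)
  have := valP T; rewrite !inE boundary_array_of_grid => /and3P[balT intT topT].
  by rewrite grid_of_arrayK ?grid_labeling_grid_of_array.
exists (fun T => exist (fun L => L \in grid_labelings lam) _ (inL T)).
exists (fun L => exist (fun T => T \in interlacing_arrays lam) _ (inT L)) => [T|L]; apply: val_inj => /=.
  by have := valP T; rewrite inE => /and3P[balT intT _]; apply: grid_of_arrayK.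
by have := valP L; rewrite inE => /andP[gridL _]; apply: array_of_gridK.
Qed.
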